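(* Let $m$ be an even positive integer not divisible by $3$. Consider an additive cellular automaton of dimension $2$ over $\mathbb{Z}/m\mathbb{Z}$ with weight array $W=(w_j)_{j\in[-r,r]^2}$ such that $\sigma=\sum_j w_j$ is invertible in $\mathbb{Z}/m\mathbb{Z}$ and $\sigma\equiv 1\pmod{2^{v_2(m)}}$. Let $a\in\mathbb{Z}/m\mathbb{Z}$, $d=(d_1,d_2)\in(\mathbb{Z}/m\mathbb{Z})^2$ and $\varepsilon\in\{-1,1\}^3$, and put $d_3:=\sigma^{-1}(\sigma_1d_1+\sigma_2d_2)$. Suppose that $\varepsilon_2d_2$, $\varepsilon_3d_3$, $\varepsilon_2d_2-\varepsilon_1d_1$ and $\varepsilon_1d_1-\varepsilon_3d_3$ are invertible in $\mathbb{Z}/m\mathbb{Z}$ and that $\gcd(\varepsilon_1d_1,m)=\gcd(\varepsilon_3d_3-\varepsilon_2d_2,m)=2$. Then, in the orbit $\mathcal{O}(\mathrm{AA}(a,d))$, every tetrahedron with orientation $\varepsilon$ and of size $s$ is balanced, for all positive integers $s\equiv 0$ or $-2\pmod{\mathrm{lcm}(\mathrm{ord}_m(\sigma),m)}$.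
   Context: $v_2(m)$ is the largest $u$ with $2^u\mid m$. An additive cellular automaton of dimension $2$ with integer weight array $W=(w_j)_{j\in[-r,r]^2}$ maps an array $(a_i)_{i\in\mathbb{Z}^2}$ of $\mathbb{Z}/m\mathbb{Z}$ to $\left(\sum_j w_ja_{i+j}\right)_{i\in\mathbb{Z}^2}$; $\sigma=\sum_jw_j$, $\sigma_k=\sum_j j_kw_j$ ($k=1,2$). The orbit $\mathcal{O}(A)$ is the array $(a_{i,j})_{(i,j)\in\mathbb{Z}^2\times\mathbb{N}}$ whose $j$-th row is $\partial^j(A)$. $\mathrm{AA}(a,d)=(a+i_1d_1+i_2d_2)_{i\in\mathbb{Z}^2}$. The tetrahedron with principal vertex $j$, orientation $\varepsilon$ and size $s$ in this array is the multiset $\{a_{j+\varepsilon\cdot k}: k\in\mathbb{N}^3,\ k_1+k_2+k_3\le s-1\}$ ($\varepsilon\cdot k$ componentwise product; all indices required to lie in $\mathbb{Z}^2\times\mathbb{N}$). Balanced means every element of $\mathbb{Z}/m\mathbb{Z}$ occurs with the same multiplicity. $\mathrm{ord}_m(\sigma)$ is the multiplicative order of $\sigma$ modulo $m$; $\gcd(x,m)$ for $x\in\mathbb{Z}/m\mathbb{Z}$ uses any representative. *)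

(* Defs.v *)
From HB Require Import structures.
From mathcomp Require Import all_boot all_order all_algebra all_fingroup.

Set Implicit Arguments.
Unset Strict Implicit.
Unset Printing Implicit Defensive.

Import GRing.Theory.
Local Open Scope ring_scope.

(* Finite index type for the box [-r, r]^2; the integer position of an index  *)
(* is given by [box_pos], which shifts both ordinals by -r.                   *)
Definition box (r : nat) : finType := ('I_r.*2.+1 * 'I_r.*2.+1)%type.

Definition box_pos (r : nat) (j : box r) : int * int :=
  (j.1%:Z - r%:Z, j.2%:Z - r%:Z).

Definition ca_step (m r : nat) (W : box r -> int) (A : int * int -> 'Z_m) :
    int * int -> 'Z_m :=
  fun i => \sum_(j : box r) (W j)%:~R * A (i + box_pos j).

Definition ca_orbit (m r : nat) (W : box r -> int) (A : int * int -> 'Z_m) :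
    int * int -> nat -> 'Z_m :=
  fun i n => iter n (@ca_step m r W) A i.

Definition sigma (r : nat) (W : box r -> int) : int := \sum_(j : box r) W j.

Definition sigma1 (r : nat) (W : box r -> int) : int :=
  \sum_(j : box r) (box_pos j).1 * W j.

Definition sigma2 (r : nat) (W : box r -> int) : int :=
  \sum_(j : box r) (box_pos j).2 * W j.

Definition AA (m : nat) (a d1 d2 : 'Z_m) : int * int -> 'Z_m :=
  fun i => a + i.1%:~R * d1 + i.2%:~R * d2.

Definition tetra_in (j3 : nat) (e3 : int) (s : nat) : Prop :=
  forall k1 k2 k3 : nat,
    (k1 + k2 + k3 <= s - 1)%N -> 0 <= j3%:Z + e3 * k3%:Z.

(* The tetrahedron as a multiset, given by the list of its entries. The row   *)
(* index j3 + e3 k3 is converted to nat by [absz], which is only meaningful   *)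
(* under [tetra_in j3 e3 s].                                                  *)
Definition tetrahedron (m : nat) (O : int * int -> nat -> 'Z_m)
    (j1 j2 : int) (j3 : nat) (e1 e2 e3 : int) (s : nat) : seq 'Z_m :=
  [seq O (j1 + e1 * k.1.1%:Z, j2 + e2 * k.1.2%:Z) (absz (j3%:Z + e3 * k.2%:Z))
  | k : 'I_s * 'I_s * 'I_s
    in [pred k : 'I_s * 'I_s * 'I_s | (k.1.1 + k.1.2 + k.2 <= s - 1)%N]].

Definition balanced (m : nat) (M : seq 'Z_m) : Prop :=
  forall x y : 'Z_m, count_mem x M = count_mem y M.

Definition ordm (m : nat) (x : 'Z_m) (ux : x \is a GRing.unit) : nat :=
  #[FinRing.unit 'Z_m ux]%g.

Definition gcdZm (m : nat) (x : 'Z_m) : nat := gcdn (nat_of_ord x) m.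

(* Main.v *)
Require Import Defs.
From mathcomp Require Import all_boot all_order all_algebra all_fingroup.
From mathcomp Require Import cyclic algC cyclotomic.
From mathcomp Require Import ring zify.

Import GRing.Theory Num.Theory.
Local Open Scope ring_scope.

(** Row [n] of the orbit is [sigma ^ n * (a + i1 d1 + i2 d2 + n d3)], so up to a
    unit the tetrahedron consists of the
    [tau ^ k * (b + i x1 + j x2 + k x3)] with [tau = sigma ^ e3]. A multiset of
    residues is balanced iff all its nontrivial character sums vanish. Let the
    character have order [q].

    If [q > 2], summing over [i] and [j] gives the closed form of a triangle sum,
    which splits the character sum into three sums over [k] of terms
    [Phi (tau ^ k) * chi (tau ^ k * (b' + k y))]. With [o] the order of [tau]
    modulo [q], such a term is multiplied by [chi (tau ^ k * o * y)] when [k]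
    increases by [o], so the sum breaks into full geometric sums. Their ratios
    differ from [1] because [y] divides [2] and [q] does not divide [2 o]: as
    [tau = 1] modulo the 2-part of [q], [o] is at most the totient of the odd
    part. When [s = -2] modulo the period, the closed form vanishes at the two missing values
    [k = s] and [k = s + 1].

    If [q = 2], the triangle sums are the integers [N./2] and cancel in pairs. *)

(** * Affine evolution of the orbit *)

(** The factor [c] makes the form stable under iteration: each step multiplies it by [sigma] and
    shifts the arithmetic array by [d3]. *)
Lemma ca_step_affine (m r : nat) (W : box r -> int) (c a d1 d2 : 'Z_m) :
  ((sigma W)%:~R : 'Z_m) \is a GRing.unit ->
  let d3 := ((sigma W)%:~R)^-1 *
    ((sigma1 W)%:~R * d1 + (sigma2 W)%:~R * d2) in
  ca_step W (fun i => c * AA a d1 d2 i) =1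
  fun i => (sigma W)%:~R * c * (AA a d1 d2 i + d3).
Proof.
move=> Us d3 i.
have E3 : (sigma W)%:~R * d3 = (sigma1 W)%:~R * d1 + (sigma2 W)%:~R * d2.
  by rewrite /d3 mulrA divrr // mul1r.
rewrite mulrDr -[_ * c * d3]mulrAC E3 /ca_step.
under eq_bigr => j _.
  have -> : (W j)%:~R * (c * AA a d1 d2 (i + box_pos j)) =
    (W j)%:~R * (c * AA a d1 d2 i) +
    (((box_pos j).1 * W j)%:~R * (c * d1)
     + ((box_pos j).2 * W j)%:~R * (c * d2)).
    by rewrite /AA /= !intrD !intrM; ring.
  over.
rewrite !big_split /= -!mulr_suml -!rmorph_sum /=.
rewrite -/(sigma W) -/(sigma1 W) -/(sigma2 W); ring.
Qed.

Lemma ca_orbit_AA (m r : nat) (W : box r -> int) (a d1 d2 : 'Z_m) i n :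
  ((sigma W)%:~R : 'Z_m) \is a GRing.unit ->
  let d3 := ((sigma W)%:~R)^-1 *
    ((sigma1 W)%:~R * d1 + (sigma2 W)%:~R * d2) in
  ca_orbit W (AA a d1 d2) i n =
  (sigma W)%:~R ^+ n * (a + i.1%:~R * d1 + i.2%:~R * d2 + n%:R * d3).
Proof.
move=> Us d3; rewrite /ca_orbit; elim: n i => [|n IHn] i.
  by rewrite /= mul0r expr0 mul1r addr0.
have eqA : iter n (ca_step W) (AA a d1 d2) =1
    fun i => (sigma W)%:~R ^+ n * AA (a + n%:R * d3) d1 d2 i.
  by move=> i'; rewrite IHn /AA; ring.
rewrite /= /ca_step; under eq_bigr => j _ do rewrite eqA.
rewrite -/(ca_step W
  (fun i => (sigma W)%:~R ^+ n * AA (a + n%:R * d3) d1 d2 i) i).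
rewrite ca_step_affine // -/d3 /AA exprS -[n.+1]addn1 natrD; ring.
Qed.

(** * Geometric and quasi-periodic sums *)

Lemma sum_expr_eq0 {F : idomainType} (w : F) n :
  w != 1 -> w ^+ n = 1 -> \sum_(i < n) w ^+ i = 0.
Proof.
move=> w1 wn; apply/eqP; have := subrX1 w n.
by rewrite wn subrr => /esym/eqP; rewrite mulf_eq0 subr_eq0 (negPf w1).
Qed.

Lemma sum_quasiperiodic {F : comNzRingType} (H w : nat -> F) o n :
  (forall i j, H (i + j * o)%N = H i * w i ^+ j) ->
  \sum_(k < n * o) H k = \sum_(i < o) H i * \sum_(j < n) w i ^+ j.
Proof.
move=> Hw; elim: n => [|n IHn].
  by rewrite big_ord0 big1 // => i _; rewrite big_ord0 mulr0.
rewrite mulSn addnC big_split_ord /= IHn -big_split /=.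
by apply: eq_bigr => i _; rewrite big_ord_recr /= mulrDr addnC Hw.
Qed.

Lemma sum_quasiperiodic_eq0 {F : idomainType} (H w : nat -> F) o N :
  (o %| N)%N -> (forall i j, H (i + j * o)%N = H i * w i ^+ j) ->
  (forall i, w i != 1) -> (forall i, w i ^+ (N %/ o) = 1) ->
  \sum_(k < N) H k = 0.
Proof.
move=> oN Hw w1 wN; rewrite -(divnK oN) (sum_quasiperiodic _ _ _ _ Hw).
by apply: big1 => i _; rewrite sum_expr_eq0 ?mulr0.
Qed.

(** * Sums over triangles *)

(* The shift by 2 in the bound [i + j <= N - 2] turns the exponents of the closed
   form into [N], and makes that form valid from [N = 0] on. *)
Definition triangle {F : comNzRingType} (A B : F) (K N : nat) : F :=
  \sum_(i < K) \sum_(j < K | (i + j + 1 < N)%N) A ^+ i * B ^+ j.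

Lemma triangle_small {F : comNzRingType} (A B : F) K N :
  (N <= 1)%N -> triangle A B K N = 0.
Proof.
move=> N1; rewrite /triangle big1 // => i _; rewrite big_pred0 // => j; lia.
Qed.

(** Raising [N] by one adds the antidiagonal [i + j = N - 1], which fits in the square because
    [N <= K]; for [N = 0] the added sum is empty. *)
Lemma triangleS {F : comNzRingType} (A B : F) K N : (N <= K)%N ->
  triangle A B K N.+1 =
  triangle A B K N + \sum_(j < N) A ^+ (N.-1 - j) * B ^+ j.
Proof.
move=> leNK; rewrite /triangle (exchange_big_dep predT) //=.
rewrite [in RHS](exchange_big_dep predT) //=.
rewrite [\sum_(j < N) _](big_ord_widen K
  (fun j => A ^+ (N.-1 - j) * B ^+ j)) //.
rewrite [X in _ = _ + X]big_mkcond -big_split /=; apply: eq_bigr => j _.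
rewrite (bigID (fun i : 'I_K => (i + j + 1 < N)%N)) /=; congr (_ + _).
  by apply: eq_bigl => i; lia.
case: ltnP => ltjN; last by rewrite big_pred0 // => i; lia.
have ltK : (N.-1 - j < K)%N by lia.
rewrite (big_pred1 (Ordinal ltK)) // => i.
by rewrite /= -val_eqE /=; lia.
Qed.

(** Each new antidiagonal sums to [(A ^ N - B ^ N) / (A - B)], and the three fractions cancel at
    [N = 0]. *)
Lemma triangle_closed {F : fieldType} (A B : F) K N :
  A != 1 -> B != 1 -> A != B -> (N <= K.+1)%N ->
  triangle A B K N = ((1 - A) * (1 - B))^-1 + A ^+ N / ((A - 1) * (A - B))
    + B ^+ N / ((B - 1) * (B - A)).
Proof.
move=> A1 B1 AB.
have [nA nB nAB] : [/\ A - 1 != 0, B - 1 != 0 & A - B != 0].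
  by rewrite !subr_eq0.
have [nA' nB' nAB'] : [/\ 1 - A != 0, 1 - B != 0 & B - A != 0].
  by rewrite !subr_eq0 ![1 == _]eq_sym [B == A]eq_sym.
elim: N => [|N IHN] leN.
  by rewrite triangle_small // !expr0; field; rewrite nA nB nAB nA' nB' nAB'.
rewrite triangleS // IHN; last exact: leqW.
have -> : \sum_(j < N) A ^+ (N.-1 - j) * B ^+ j = (A ^+ N - B ^+ N) / (A - B).
  by rewrite subrXX mulrAC divff // mul1r.
by rewrite !exprS; field; rewrite nA nB nAB nA' nB' nAB'.
Qed.

(** The antidiagonal added at step [N] consists of [N] alternating signs starting with 1, so it sums
    to the parity of [N]. *)
Lemma triangle_1N1 {F : comNzRingType} K N : (N <= K.+1)%N ->
  triangle (1 : F) (-1) K N = N./2%:R.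
Proof.
elim: N => [|N IHN] leN; first by rewrite triangle_small.
rewrite triangleS // IHN; last exact: leqW.
have -> : \sum_(j < N) 1 ^+ (N.-1 - j) * (-1) ^+ j = (odd N)%:R :> F.
  under eq_bigr do rewrite expr1n mul1r.
  elim: (N) => [|n IHn]; first by rewrite big_ord0.
  rewrite big_ord_recr /= IHn -signr_odd.
  by case: (odd n); rewrite /= ?expr1 ?subrr ?expr0 ?add0r.
by rewrite -natrD; congr (_%:R); lia.
Qed.

(** The terms [k = 2i] and [k = 2i + 1] cancel: [2n - 1 - 2i] and [2n - 2 - 2i] have the same half,
    rounded down. *)
Lemma alternating_half_sum {F : comNzRingType} n :
  \sum_(k < n.*2) (-1) ^+ k * ((n.*2).-1 - k)./2%:R = 0 :> F.
Proof.
elim: n => [|n IHn]; first by rewrite big_ord0.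
rewrite doubleS 2!big_ord_recl /=.
rewrite -[X in _ + (_ + X)]/(\sum_(k < n.*2)
  (-1) ^+ k.+2 * (n.*2.+1 - k.+2)./2%:R).
under eq_bigr => k _.
  rewrite !exprS !mulN1r opprK.
  have -> : (n.*2.+1 - k.+2 = n.*2.-1 - k)%N by lia.
  over.
rewrite IHn addr0 expr0 mul1r mulN1r /bump /= ?subn1 /=.
by rewrite uphalf_double doubleK subrr.
Qed.

(** * Additive characters and balance *)

Definition Zp_char {F : comNzRingType} (m : nat) (z : F) (x : 'Z_m) : F :=
  z ^+ (x : nat).
Arguments Zp_char {F m} z x.

Lemma Zp_char_nat {F : comNzRingType} m (z : F) n :
  (1 < m)%N -> z ^+ m = 1 -> Zp_char z (n%:R : 'Z_m) = z ^+ n.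
Proof. by move=> m1 zm; rewrite /Zp_char val_Zp_nat // expr_mod. Qed.

Lemma Zp_charD {F : comNzRingType} m (z : F) (x y : 'Z_m) :
  (1 < m)%N -> z ^+ m = 1 -> Zp_char z (x + y) = Zp_char z x * Zp_char z y.
Proof.
by move=> m1 zm; rewrite -[x]natr_Zp -[y]natr_Zp -natrD !Zp_char_nat // exprD.
Qed.

Lemma Zp_charM {F : comNzRingType} m (z : F) (x y : 'Z_m) :
  (1 < m)%N -> z ^+ m = 1 -> Zp_char z (x * y) = Zp_char z x ^+ (y : nat).
Proof.
move=> m1 zm; rewrite -{1}[x]natr_Zp -{1}[y]natr_Zp -natrM Zp_char_nat //.
by rewrite exprM.
Qed.

Lemma Zp_charMn {F : comNzRingType} m (z : F) (x : 'Z_m) n :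
  (1 < m)%N -> z ^+ m = 1 -> Zp_char z (x * n%:R) = Zp_char z x ^+ n.
Proof.
by move=> m1 zm; rewrite -[x]natr_Zp -natrM !Zp_char_nat // exprM.
Qed.

(** Fourier inversion: in [S] the trivial character contributes [size M] and the others vanish,
    while orthogonality leaves [m] for each occurrence of [x]. All multiplicities are thus
    [size M / m]. *)
Lemma Zp_char_balanced m (M : seq 'Z_m) : (1 < m)%N ->
  (forall z : algC, z ^+ m = 1 -> z != 1 -> \sum_(v <- M) Zp_char z v = 0) ->
  balanced M.
Proof.
move=> m1 sum0; have m0 : (0 < m)%N by lia.
have [zeta prim] := C_prim_root_exists m0.
have zm := prim_expr_order prim.
suff countE x : (count_mem x M * m = size M)%N.
  move=> x y; apply/eqP; rewrite -(eqn_pmul2r m0); apply/eqP.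
  by rewrite !countE.
(* The exponent [m - x] stands for [-x]. *)
pose S := \sum_(u < m) \sum_(v <- M) zeta ^+ u ^+ (v + (m - x)).
have lt_m (v : 'Z_m) : (v < m)%N by rewrite -{2}(Zp_cast m1).
have Ssize : S = (size M)%:R.
  rewrite /S (bigD1 (Ordinal m0)) //= [X in _ + X]big1 ?addr0 => [|u u0].
    rewrite (eq_bigr (fun=> 1)) => [|v _]; last by rewrite expr0 expr1n.
    by rewrite big_const_seq count_predT iter_addr_0.
  under eq_bigr do rewrite exprD; rewrite -mulr_suml.
  rewrite [X in X * _]sum0 ?mul0r //.
    by rewrite exprAC zm expr1n.
  rewrite -(prim_order_dvd prim) gtnNdvd // lt0n.
  by move: u0; rewrite -val_eqE.
have Scount : S = (count_mem x M * m)%:R.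
  rewrite /S exchange_big /= mulnC natrM -sum1_count natr_sum mulr_sumr.
  rewrite [RHS]big_mkcond /=; apply: eq_bigr => v _.
  under eq_bigr do rewrite exprAC.
  have ltv := lt_m v; have ltx := lt_m x.
  case: eqP => [->|/eqP nvx].
    rewrite subnKC; last exact: ltnW.
    under eq_bigr do rewrite zm expr1n.
    by rewrite sumr_const card_ord mulr1.
  rewrite sum_expr_eq0 //; last by rewrite exprAC zm expr1n.
  rewrite -(prim_order_dvd prim); apply: contra nvx.
  (* As [0 < v + (m - x) < 2m], divisibility by [m] forces [v = x]. *)
  rewrite -val_eqE /= => /dvdnP [[|[|k]]]; move: ltv ltx.
  - by move: (nat_of_ord v) (nat_of_ord x) => i j; lia.
  - by move: (nat_of_ord v) (nat_of_ord x) => i j; lia.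
  by move: (nat_of_ord v) (nat_of_ord x) => i j; nia.
apply/eqP; rewrite -(eqr_nat algC) -Scount -Ssize; exact/eqP.
Qed.

(** * Multiplicative order modulo the order of a character *)

Lemma totient_lt n : (1 < n)%N -> (totient n < n)%N.
Proof.
case: n => // n n1; rewrite totient_count_coprime big_ltn // /coprime gcdn0.
rewrite gtn_eqF // add0n ltnS -[leqRHS](subn1 n.+1) -[leqRHS]muln1.
by rewrite -sum_nat_const_nat; apply: leq_sum => i _; case: (_ == _).
Qed.

(** Write [Q] for the odd part of [q]. The Chinese remainder theorem and Euler's theorem give
    [t ^ totient Q = 1] modulo [q], so the least exponent [o] is at most [totient Q]. *)
Lemma modn_order_exists q t : (2 < q)%N -> coprime t q ->
  (t = 1 %[mod q`_2])%N ->
  exists o, [/\ (t ^ o = 1 %[mod q])%N,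
    forall N, (t ^ N = 1 %[mod q])%N -> (o %| N)%N & ~~ (q %| 2 * o)%N].
Proof.
move=> q2 co_tq t1; have q0 : (0 < q)%N by lia.
pose P n := ((0 < n) && (t ^ n == 1 %[mod q]))%N.
have qE := partnC 2%N q0.
have Ptot : P (totient q`_2^'%N).
  have : (t ^ totient q`_2^' == 1 %[mod q`_2 * q`_2^'])%N.
    rewrite chinese_remainder ?coprime_partC //; apply/andP; split.
      by rewrite -modnXm t1 modnXm exp1n.
    apply/eqP/Euler_exp_totient; apply: coprime_dvdr co_tq.
    exact: dvdn_part.
  by rewrite qE /P totient_gt0 part_gt0.
have exP : exists n, P n by exists (totient q`_2^'%N).
case: (ex_minnP exP) => o /andP[o0 /eqP to] omin; exists o; split=> // [N tN|].
  rewrite /dvdn; apply: contraT; rewrite -lt0n => r0.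
  have := ltn_pmod N o0; rewrite ltnNge omin // /P r0 /=.
  have toq : (t ^ (N %/ o * o) = 1 %[mod q])%N.
    by rewrite mulnC expnM -modnXm to modnXm exp1n.
  apply/eqP; rewrite -tN [in RHS](divn_eq N o) expnD.
  by rewrite -modnMml toq modnMml mul1n.
have le_o := omin _ Ptot.
apply/negP => q2o; have q_le : (q <= 2 * o)%N by apply: dvdn_leq => //; lia.
have Q0 : (0 < q`_2^')%N := part_gt0 _ _.
(* If [Q = 1], then [o = 1], and [q > 2] cannot divide 2. *)
have [Q1|Q1] := leqP (q`_2^')%N 1.
  have Q_eq1 : (q`_2^' = 1)%N by lia.
  by rewrite Q_eq1 -[totient 1]/1%N in le_o; lia.
have oQ := leq_ltn_trans le_o (totient_lt _ Q1).
(* If the 2-part is at least 2, then [2o < 2Q <= q]. Otherwise [q] is odd and would divide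
   [o < q]. *)
have [P1|P1] := leqP (q`_2)%N 1; last by nia.
have P1' : (q`_2 == 1)%N by rewrite eqn_leq P1 part_gt0.
have co_q2 : coprime q 2.
  by rewrite coprime_sym prime_coprime // -p'natE // -partn_eq1.
by move: q2o; rewrite Gauss_dvdr // => /(dvdn_leq o0); nia.
Qed.

(** The condition [u * y = 2] covers both units and elements with gcd 2. A value 1, raised to the
    power [t^-1 * u], would give [z ^ (2n) = 1]. *)
Lemma Zp_char_neq1 {F : fieldType} m q (z : F) (t y : 'Z_m) n :
  (1 < m)%N -> q.-primitive_root z -> (q %| m)%N -> t \is a GRing.unit ->
  (exists u, u * y = 2) -> ~~ (q %| 2 * n)%N -> Zp_char z (t * y * n%:R) != 1.
Proof.
move=> m1 prim qm Ut [u uy]; apply: contra => /eqP w1.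
have zm : z ^+ m = 1 by apply/eqP; rewrite -(prim_order_dvd prim).
rewrite (prim_order_dvd prim) -(Zp_char_nat m) // natrM.
have -> : 2%:R * n%:R = (t * y * n%:R) * (t^-1 * u) :> 'Z_m.
  by rewrite -uy -[u * y * _]mul1r -(mulVr Ut); ring.
by rewrite Zp_charM // w1 expr1n.
Qed.

(** [Phi] is arbitrary because its arguments depend on [k] only modulo [o]; only the linear phase
    changes from one period to the next. The hypothesis [m %| N] closes the geometric sums. *)
Lemma Zp_char_twisted_sum {F : fieldType} m q (z : F) (tau : 'Z_m) o N
    (Phi : F -> F -> F) (x1 x2 b y : 'Z_m) :
  (1 < m)%N -> q.-primitive_root z -> (q %| m)%N ->
  tau \is a GRing.unit -> (tau ^ o = 1 %[mod q])%N -> (o %| N)%N ->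
  ~~ (q %| 2 * o)%N -> (m %| N)%N -> (exists u, u * y = 2) ->
  \sum_(k < N) Phi (Zp_char z (tau ^+ k * x1)) (Zp_char z (tau ^+ k * x2))
    * Zp_char z (tau ^+ k * (b + k%:R * y)) = 0.
Proof.
move=> m1 prim qm Utau tauo oN q2o mN Dy.
have zm : z ^+ m = 1 by apply/eqP; rewrite -(prim_order_dvd prim).
(* The character sees exponents only modulo [q], so [tau ^ o = 1] is needed modulo [q], not modulo
   [m]. *)
have period i j x :
    Zp_char z (tau ^+ (i + j * o) * x) = Zp_char z (tau ^+ i * x).
  rewrite !(Zp_charM m) //; congr (_ ^+ _).
  rewrite -[tau]natr_Zp -!natrX !(Zp_char_nat m) //; apply/eqP.
  rewrite (eq_prim_root_expr prim) expnD mulnC [(j * o)%N]mulnC expnM.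
  by rewrite -modnMml -modnXm tauo modnXm exp1n modnMml mul1n.
pose w i := Zp_char z (tau ^+ i * y * o%:R).
pose H k := Phi (Zp_char z (tau ^+ k * x1)) (Zp_char z (tau ^+ k * x2))
  * Zp_char z (tau ^+ k * (b + k%:R * y)).
apply: (sum_quasiperiodic_eq0 H w o N) => // [i j|i|i]; rewrite {}/H.
- rewrite !period -mulrA; congr (_ * _).
  rewrite /w -Zp_charMn // -Zp_charD //; congr (Zp_char z _).
  by rewrite natrD natrM; ring.
- by apply: (Zp_char_neq1 m q z) => //; exact: unitrX.
rewrite /w -Zp_charMn // -mulrA -natrM mulnC divnK //.
have -> : N%:R = 0 :> 'Z_m.
  by case/dvdnP: mN => k ->; rewrite natrM pchar_Zp ?mulr0.
by rewrite mulr0 /Zp_char expr0.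
Qed.

(** * Character sums over tetrahedra *)

Definition tetra_char_sum {F : comNzRingType} {m : nat} (z : F)
    (tau b x1 x2 x3 : 'Z_m) (s : nat) : F :=
  \sum_(k < s) \sum_(i < s) \sum_(j < s | (i + j + k <= s - 1)%N)
    Zp_char z (tau ^+ k * (b + i%:R * x1 + j%:R * x2 + k%:R * x3)).

(** For [N = s + 2] the extra slices [k = s] and [k = s + 1] are empty triangles, with bounds 1 and
    0. *)
Lemma tetra_char_sumE {F : comNzRingType} {m : nat} (z : F)
    (tau b x1 x2 x3 : 'Z_m) (s N : nat) :
  (1 < m)%N -> z ^+ m = 1 -> (N = s \/ N = s.+2) ->
  tetra_char_sum z tau b x1 x2 x3 s =
  \sum_(k < N) Zp_char z (tau ^+ k * (b + k%:R * x3)) *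
    triangle (Zp_char z (tau ^+ k * x1)) (Zp_char z (tau ^+ k * x2)) s
      (s.+1 - k).
Proof.
move=> m1 zm HN; pose G k := Zp_char z (tau ^+ k * (b + k%:R * x3)) *
    triangle (Zp_char z (tau ^+ k * x1)) (Zp_char z (tau ^+ k * x2)) s
      (s.+1 - k).
rewrite -[RHS]/(\sum_(k < N) G k).
have -> : \sum_(k < N) G k = \sum_(k < s) G k.
  case: HN => -> //; rewrite 2!big_ord_recr /= /G.
  by rewrite !triangle_small ?mulr0 ?addr0 //; lia.
apply: eq_bigr => k _; rewrite /G mulr_sumr; apply: eq_bigr => i _.
rewrite mulr_sumr; apply: eq_big => [j|j _]; first by have := ltn_ord k; lia.
rewrite -!Zp_charMn // -!Zp_charD //; congr (Zp_char z _); ring.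
Qed.

(** The conditions on [x1], [x2] and [x1 - x2] make the denominators of the closed form nonzero;
    [x3], [x3 - x1] and [x3 - x2] are the slopes of its three phases. *)
Lemma tetra_char_sum_order_gt2 {F : fieldType} {m q : nat} (z : F)
    (tau b x1 x2 x3 : 'Z_m) (s N : nat) :
  (1 < m)%N -> q.-primitive_root z -> (q %| m)%N -> (2 < q)%N ->
  tau \is a GRing.unit -> (tau = 1 %[mod 2 ^ logn 2 m])%N ->
  (m %| N)%N -> tau ^+ N = 1 -> (N = s \/ N = s.+2) ->
  (exists u, u * x1 = 2) -> (exists u, u * x2 = 2) ->
  (exists u, u * x3 = 2) -> (exists u, u * (x1 - x2) = 2) ->
  (exists u, u * (x3 - x1) = 2) -> (exists u, u * (x3 - x2) = 2) ->
  tetra_char_sum z tau b x1 x2 x3 s = 0.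
Proof.
move=> m1 prim qm q2 Utau tau1 mN tauN HN D1 D2 D3 D12 D31 D32.
have zm : z ^+ m = 1 by apply/eqP; rewrite -(prim_order_dvd prim).
have m0 : (0 < m)%N by lia.
have co_tm : coprime tau m by rewrite coprime_sym -unitZpE // natr_Zp.
have [||o [tauo oP q2o]] := modn_order_exists q tau q2.
- exact: coprime_dvdr co_tm.
- have dv : (q`_2 %| 2 ^ logn 2 m)%N by rewrite -p_part; exact: partn_dvd.
  by rewrite -(modn_dvdm tau dv) tau1 modn_dvdm.
have oN : (o %| N)%N.
  have : ((tau ^ N)%N%:R : 'Z_m) = 1%:R by rewrite natrX natr_Zp tauN.
  move=> /(congr1 (@nat_of_ord _)); rewrite !val_Zp_nat // => tN.
  by apply: oP; rewrite -(modn_dvdm _ qm) tN modn_dvdm.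
have neq1 k y : (exists u, u * y = 2) -> Zp_char z (tau ^+ k * y) != 1.
  move=> Dy; rewrite -[_ * y]mulr1.
  apply: (Zp_char_neq1 m q z _ _ 1%N) => //; first exact: unitrX.
  by rewrite gtnNdvd.
have z0 : z != 0.
  by apply: contra_eq_neq zm => ->; rewrite expr0n gtn_eqF // eq_sym oner_eq0.
rewrite (tetra_char_sumE _ _ _ _ _ _ _ _ m1 zm HN).
have S0 Phi b' y := Zp_char_twisted_sum m q z tau o N Phi x1 x2 b' y
  m1 prim qm Utau tauo oN q2o mN.
have S1 := S0 (fun A B => ((1 - A) * (1 - B))^-1) b x3 D3.
(* The power [A ^ (s + 1 - k)] adds [(s + 1 - k) * x1] to the phase, which moves the base point by
   [(s + 1) * x1] and the slope by [-x1]. *)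
have S2 := S0 (fun A B => ((A - 1) * (A - B))^-1) (b + s.+1%:R * x1) _ D31.
have S3 := S0 (fun A B => ((B - 1) * (B - A))^-1) (b + s.+1%:R * x2) _ D32.
transitivity (0 + 0 + 0 : F); last by rewrite !addr0.
rewrite -[X in _ = X + _ + _]S1 -[X in _ = _ + X + _]S2 -[X in _ = _ + X]S3.
rewrite -!big_split /=; apply: eq_bigr => k _.
have lek : (k <= s.+1)%N.
  by rewrite -ltnS (leq_trans (ltn_ord k)) //; case: HN => -> //; exact: leqW.
rewrite triangle_closed ?leq_subr ?neq1 //; last first.
  (* The quotient [A / B] is the character at [tau ^ k * (x1 - x2)]. *)
  apply: contra (neq1 k _ D12) => /eqP eqAB.
  rewrite -subr_eq0 -(mulIr_eq0 _ (mulIf (expf_neq0 (tau ^+ k * x2)%R z0))).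
  rewrite mulrBl mul1r -/(Zp_char z (tau ^+ k * x2)) -Zp_charD //.
  by rewrite -mulrDr subrK eqAB subrr.
have shift x : Zp_char z (tau ^+ k * (b + s.+1%:R * x + k%:R * (x3 - x))) =
    Zp_char z (tau ^+ k * (b + k%:R * x3)) *
    Zp_char z (tau ^+ k * x) ^+ (s.+1 - k).
  rewrite -Zp_charMn // -Zp_charD // natrB //; congr (Zp_char z _); ring.
rewrite !shift; ring.
Qed.

Lemma tetra_char_sum_N1 {F : fieldType} {m : nat}
    (tau b x1 x2 x3 : 'Z_m) (s : nat) :
  (2 %| m)%N -> (1 < m)%N -> ~~ odd s -> odd tau -> ~~ odd x1 ->
  odd x2 -> odd x3 ->
  tetra_char_sum (-1 : F) tau b x1 x2 x3 s = 0.
Proof.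
move=> m2 m1 s2 otau ox1 ox2 ox3.
have zm : (-1 : F) ^+ m = 1 by rewrite -signr_odd -[odd m]negbK -dvdn2 m2.
have chE x : Zp_char (-1 : F) x = (-1) ^+ odd x by rewrite signr_odd.
have cht k (x : 'Z_m) : Zp_char (-1 : F) (tau ^+ k * x) = (-1) ^+ odd x.
  elim: k x => [|k IHk] x; first by rewrite mul1r.
  by rewrite exprSr -mulrA IHk -chE mulrC Zp_charM // chE -exprM
    -[LHS]signr_odd oddM otau andbT oddb.
(* Only the parity of [s] matters here, so [s + 2] terms are taken in both cases, to match
   [alternating_half_sum] with [n = s / 2 + 1]. *)
rewrite (tetra_char_sumE _ _ _ _ _ _ _ s.+2 m1 zm); last by right.
under eq_bigr => k _.
  rewrite !cht (negPf ox1) ox2 expr0 expr1 triangle_1N1 ?leq_subr //.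
  rewrite -chE Zp_charD // [k%:R * x3]mulrC Zp_charMn // !chE ox3 expr1 -mulrA.
  over.
have sE : s.+2 = (s./2.+1).*2 by rewrite doubleS even_halfK.
rewrite -mulr_sumr; have := @alternating_half_sum F s./2.+1.
by rewrite -sE => ->; rewrite mulr0.
Qed.

(** * Parity and divisors of 2 in Z/m *)

Lemma Zp_intr_eq0 {m : nat} (n : int) :
  (1 < m)%N -> n%:~R = 0 :> 'Z_m -> (m %| n)%Z.
Proof.
move=> m1 n0; rewrite dvdzE /=.
have : `|n|%N%:R = 0 :> 'Z_m.
  case: n n0 => n; rewrite ?NegzE ?abszN //.
  by rewrite rmorphN => /eqP; rewrite oppr_eq0 => /eqP.
by move/(congr1 (@nat_of_ord _)); rewrite val_Zp_nat // => /eqP.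
Qed.

Lemma odd_Zp_mul {m : nat} (x y : 'Z_m) :
  (1 < m)%N -> (2 %| m)%N -> odd (x * y : 'Z_m)%R = odd x && odd y.
Proof.
move=> m1 m2; rewrite -{1}[x]natr_Zp -{1}[y]natr_Zp -natrM val_Zp_nat //.
have := modn_dvdm (x * y) m2; rewrite !modn2 -oddM.
by do 2![case: odd].
Qed.

Lemma odd_Zp_unit {m : nat} (x : 'Z_m) :
  (1 < m)%N -> (2 %| m)%N -> x \is a GRing.unit -> odd x.
Proof.
move=> m1 m2; rewrite -{1}[x]natr_Zp unitZpE // => co_mx.
by rewrite -coprime2n; exact: coprime_dvdl co_mx.
Qed.

Lemma Zp_unit_dvd2 {m : nat} (c x : 'Z_m) :
  c \is a GRing.unit -> x \is a GRing.unit -> exists u, u * (c * x) = 2.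
Proof.
move=> Uc Ux; exists (2 * (c * x)^-1).
by rewrite divrK // unitrM Uc.
Qed.

Lemma gcdZm2_dvd2 {m : nat} (c x : 'Z_m) : (1 < m)%N ->
  c \is a GRing.unit -> gcdZm x = 2%N -> exists u, u * (c * x) = 2.
Proof.
move=> m1 Uc gx; have m0 : (0 < m)%N by exact: ltnW.
have [a _] := Bezoutl x m0; rewrite gcdnC -/(gcdZm x) gx => /dvdnP[k ak].
(* Bezout gives [m] dividing [2 + a * x], hence [-a * x = 2]. *)
exists (- a%:R * c^-1); rewrite mulrA divrK //.
have : (2 + a * x)%:R = 0 :> 'Z_m by rewrite ak natrM pchar_Zp // mulr0.
by rewrite natrD natrM natr_Zp mulNr => /eqP; rewrite addr_eq0 => /eqP ->.
Qed.

Lemma eqn_mod1_dvdz (t d : nat) : (d %| t%:Z - 1)%Z -> (t = 1 %[mod d])%N.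
Proof.
by rewrite -eqz_mod_dvd => /eqP; rewrite -[1]/(1%N%:Z) !modz_nat => -[].
Qed.

Lemma tetra_char_sum_eq0 {m : nat} (z : algC)
    (tau c b x1 x2 x3 : 'Z_m) (s N : nat) :
  (1 < m)%N -> (2 %| m)%N -> z ^+ m = 1 -> z != 1 ->
  tau \is a GRing.unit -> (tau = 1 %[mod 2 ^ logn 2 m])%N ->
  (m %| N)%N -> tau ^+ N = 1 -> (N = s \/ N = s.+2) ->
  c \is a GRing.unit -> x2 \is a GRing.unit -> x3 \is a GRing.unit ->
  x2 - x1 \is a GRing.unit -> x1 - x3 \is a GRing.unit ->
  gcdZm x1 = 2%N -> gcdZm (x3 - x2) = 2%N ->
  tetra_char_sum z tau b (c * x1) (c * x2) (c * x3) s = 0.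
Proof.
move=> m1 m2 zm z1 Utau tau1 mN tauN HN Uc U2 U3 U21 U13 g1 g32.
have m0 : (0 < m)%N by exact: ltnW.
have [q prim qm] := prim_order_exists m0 zm.
have q0 := prim_order_gt0 prim; have zq := prim_expr_order prim.
have [q2|] := ltnP 2 q.
  apply: (tetra_char_sum_order_gt2 _ _ _ _ _ _ _ N m1 prim) => //;
    rewrite -?mulrBr; try exact: Zp_unit_dvd2; try exact: gcdZm2_dvd2.
    (* The two differences left, [x1 - x2] and [x3 - x1], are opposites of the given units. *)
    by apply: Zp_unit_dvd2; rewrite // -opprB unitrN.
  by apply: Zp_unit_dvd2; rewrite // -opprB unitrN.
case: q q0 zq {prim qm} => [|[|[|q]]] // _.
  by rewrite expr1 => /eqP; rewrite (negPf z1).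
move/eqP; rewrite sqrf_eq1 (negPf z1) /= => /eqP -> _.
have oc := odd_Zp_unit _ m1 m2 Uc.
have o2 := odd_Zp_unit _ m1 m2 U2; have o3 := odd_Zp_unit _ m1 m2 U3.
apply: tetra_char_sum_N1;
  rewrite ?odd_Zp_mul ?oc ?o2 ?o3 ?(odd_Zp_unit tau) //=.
  have : ~~ odd N by rewrite -dvdn2; exact: dvdn_trans mN.
  by case: HN => -> //=; rewrite negbK.
by rewrite -dvdn2 -g1; exact: dvdn_gcdl.
Qed.

(** * From the orbit to character sums *)

Lemma tetrahedron_char_sum {F : comNzRingType} {m : nat} (z : F)
    (O : int * int -> nat -> 'Z_m) (j1 j2 : int) (j3 : nat) (e1 e2 e3 : int)
    (tau b x1 x2 x3 : 'Z_m) (s : nat) :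
  (forall k1 k2 k3 : nat, (k1 + k2 + k3 <= s - 1)%N ->
    O (j1 + e1 * k1%:Z, j2 + e2 * k2%:Z) (absz (j3%:Z + e3 * k3%:Z)) =
    tau ^+ k3 * (b + k1%:R * x1 + k2%:R * x2 + k3%:R * x3)) ->
  \sum_(v <- tetrahedron O j1 j2 j3 e1 e2 e3 s) Zp_char z v =
  tetra_char_sum z tau b x1 x2 x3 s.
Proof.
move=> OE; rewrite /tetrahedron big_image /=.
under eq_bigr => k Pk do rewrite OE //.
rewrite big_mkcond /=.
pose G (ij : 'I_s * 'I_s) (k : 'I_s) :=
  if (ij.1 + ij.2 + k <= s - 1)%N then
    Zp_char z (tau ^+ k * (b + ij.1%:R * x1 + ij.2%:R * x2 + k%:R * x3)) else 0.
rewrite -[LHS]/(\sum_p G p.1 p.2) -(pair_bigA _ G) exchange_big /=.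
apply: eq_bigr => k _.
rewrite -(pair_bigA _ (fun i j => G (i, j) k)) /=.
by apply: eq_bigr => i _; rewrite [RHS]big_mkcond.
Qed.

Theorem theorem4p5 (m : nat) (m_gt0 : (0 < m)%N) (m_even : (2 %| m)%N)
    (m_n3 : ~~ (3 %| m)%N)
    (r : nat) (W : box r -> int)
    (sigma_unit : ((sigma W)%:~R : 'Z_m) \is a GRing.unit)
    (sigma_mod : (sigma W = 1 %[mod (2 ^ logn 2 m)%N%:Z])%Z)
    (a d1 d2 : 'Z_m) (e1 e2 e3 : int)
    (e1P : e1 = -1 \/ e1 = 1) (e2P : e2 = -1 \/ e2 = 1)
    (e3P : e3 = -1 \/ e3 = 1) :
  let d3 : 'Z_m := ((sigma W)%:~R)^-1 *
    ((sigma1 W)%:~R * d1 + (sigma2 W)%:~R * d2) in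
  let x1 : 'Z_m := e1%:~R * d1 in
  let x2 : 'Z_m := e2%:~R * d2 in
  let x3 : 'Z_m := e3%:~R * d3 in
  x2 \is a GRing.unit ->
  x3 \is a GRing.unit ->
  x2 - x1 \is a GRing.unit ->
  x1 - x3 \is a GRing.unit ->
  gcdZm x1 = 2%N ->
  gcdZm (x3 - x2) = 2%N ->
  forall s : nat, (0 < s)%N ->
  let L := (lcmn (ordm sigma_unit) m)%:Z in
  (s%:Z = 0 %[mod L])%Z \/ (s%:Z = -2 %[mod L])%Z ->
  forall (j1 j2 : int) (j3 : nat), tetra_in j3 e3 s ->
  balanced (tetrahedron (ca_orbit W (AA a d1 d2)) j1 j2 j3 e1 e2 e3 s).
Proof.
move=> d3 x1 x2 x3 U2 U3 U21 U13 g1 g32 s s0 L HL j1 j2 j3 in3.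
have m1 : (1 < m)%N by rewrite (dvdn_leq m_gt0 m_even).
set S : 'Z_m := (sigma W)%:~R in sigma_unit d3 x3 U3 U13 g32 L HL *.
(* [N] is whichever of [s] and [s + 2] is a multiple of the period. *)
have [N NE LN] : exists2 N, N = s \/ N = s.+2 &
    (lcmn (ordm sigma_unit) m %| N)%N.
  case: HL => /eqP; rewrite eqz_mod_dvd.
    by rewrite subr0 => LN; exists s; [left | exact: LN].
  by rewrite opprK -PoszD addn2 => LN; exists s.+2; [right | exact: LN].
have mN := dvdn_trans (dvdn_lcmr _ _) LN.
have SN : S ^+ N = 1.
  have := dvdn_trans (dvdn_lcml _ _) LN; rewrite order_dvdn => /eqP.
  by move/(congr1 val); rewrite FinRing.val_unitX.
pose d := (2 ^ logn 2 m)%N.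
have dm : (d %| m)%N by rewrite /d -p_part dvdn_part.
have dmz : (d%:Z %| m%:Z)%Z by [].
have dS : (d %| sigma W - 1)%Z by rewrite -eqz_mod_dvd; exact/eqP.
(* An integer power: with [e3 = -1] the tetrahedron runs towards earlier rows. *)
pose tau := S ^ e3.
have Utau : tau \is a GRing.unit by rewrite unitrXz.
have tauN : tau ^+ N = 1 by rewrite exprnP exprzAC -exprnP SN exp1rz.
have tauE (k : nat) : 0 <= j3%:Z + e3 * k%:Z ->
    S ^+ absz (j3%:Z + e3 * k%:Z) = S ^+ j3 * tau ^+ k.
  by move=> jk; rewrite [LHS]exprnP gez0_abs // exprzDr // -exprz_exp.
have tau1 : (tau = 1 %[mod d])%N.
  apply: eqn_mod1_dvdz; have tR : (tau : nat)%:R = tau := natr_Zp tau.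
  move: (nat_of_ord tau) tR => t tR.
  case: e3P => e3E; rewrite /tau e3E in tR.
    (* Here [e3 = -1]: [t] inverts [sigma] modulo [m], hence modulo [d], where [sigma] is 1. *)
    have : (m %| t%:Z * sigma W - 1)%Z.
      apply: (Zp_intr_eq0 _ m1); rewrite rmorphB rmorphM /= -/S.
      by rewrite [X in X * S]tR mulVr // subrr.
    move=> /(dvdz_trans dmz) dt.
    have -> : t%:Z - 1 = (t%:Z * sigma W - 1) - t%:Z * (sigma W - 1) by ring.
    by rewrite rpredB // dvdz_mull.
  have : (m %| t%:Z - sigma W)%Z.
    apply: (Zp_intr_eq0 _ m1); rewrite rmorphB /= -/S.
    by rewrite [X in X - S]tR subrr.
  move=> /(dvdz_trans dmz) dt.
  have -> : t%:Z - 1 = (t%:Z - sigma W) + (sigma W - 1) by ring.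
  by rewrite rpredD.
apply: (Zp_char_balanced _ _ m1) => z zm z1.
(* The entry at the principal vertex; its unit [S ^ j3] also scales the three slopes. *)
pose b := S ^+ j3 * (a + j1%:~R * d1 + j2%:~R * d2 + j3%:R * d3).
rewrite (tetrahedron_char_sum _ _ _ _ _ _ _ _ tau b
  (S ^+ j3 * x1) (S ^+ j3 * x2) (S ^+ j3 * x3)).
  by apply: (tetra_char_sum_eq0 _ _ _ _ _ _ _ _ N) => //; exact: unitrX.
move=> k1 k2 k3 Pk; have jk := in3 _ _ _ Pk.
rewrite ca_orbit_AA // -/S -/d3 tauE //.
have -> : (absz (j3%:Z + e3 * k3%:Z))%:R = j3%:R + e3%:~R * k3%:R :> 'Z_m.
  by rewrite -[LHS]/((Posz _)%:~R) gez0_abs // rmorphD rmorphM.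
rewrite /= !rmorphD !rmorphM /= /b /x1 /x2 /x3.
change (k1%:~R : 'Z_m) with (k1%:R : 'Z_m).
change (k2%:~R : 'Z_m) with (k2%:R : 'Z_m).
ring.
Qed.
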